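(* Let $\lambda\in\mathbb{R}$. Let $(X,d_X)$ be a metric space, and let $E:X\to(-\infty,\infty]$. Suppose $Y\subset X$, equipped with its induced length metric $d_Y$, is such that $(Y,d_Y)$ is a geodesic space. Assume that $E$ is geodesically $\lambda$-convex in $Y$, and that $E$ satisfies the following HWI inequality in $(Y,d_X|_{Y\times Y})$: $$E(x)\le E(x')+d_X(x,x')\,|\partial E|(x)-\frac\lambda2d_X^2(x,x'),\qquad\forall x\in Y\cap D(|\partial E|),\ x'\in Y.$$ Then $E$ satisfies the HWI inequality in $(Y,d_Y)$: $$E(y)\le E(y')+d_Y(y,y')\,|\partial E|(y)-\frac\lambda2d_Y^2(y,y'),\qquad\forall y\in Y\cap D(|\partial E|),\ y'\in Y.$$
   Context: Slope: $|\partial E|:X\to[0,\infty]$ is $|\partial E|(x)=\infty$ if $E(x)=\infty$, $|\partial E|(x)=0$ if $x$ is isolated (and $E(x)<\infty$), and otherwise $|\partial E|(x)=\limsup_{y\to x}\frac{(E(x)-E(y))_+}{d_X(x,y)}$ (limsup in $(X,d_X)$). $D(|\partial E|)=\{|\partial E|<\infty\}$. Absolutely continuous curves: $AC([0,1];(X,d_X))$ is the set of maps $\gamma:[0,1]\to X$ for which there is $m\in L^1([0,1])$ with $d_X(\gamma_s,\gamma_t)\le\int_s^tm(u)\,du$ for all $s<t$. The metric derivative is $|\dot\gamma|_t=\limsup_{s\to t}d_X(\gamma_s,\gamma_t)/|s-t|$. Induced length metric on $Y\subset X$: $d_Y(y,y')=\inf\int_0^1|\dot\gamma|_t\,dt$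 over $\gamma\in AC([0,1];(X,d_X))$ with $\gamma_t\in Y$ for all $t$, $\gamma_0=y$, $\gamma_1=y'$ (with $\inf\emptyset=+\infty$). A $Y$-geodesic is a curve $\gamma:[0,1]\to Y$ with $d_Y(\gamma_s,\gamma_t)=|t-s|\,d_Y(\gamma_0,\gamma_1)<\infty$ for all $s,t\in[0,1]$. $(Y,d_Y)$ is a geodesic space if every pair of points of $Y$ is joined by a $Y$-geodesic. $E$ is geodesically $\lambda$-convex in $Y$ if for every $Y$-geodesic $\gamma$ and all $t\in[0,1]$, $E(\gamma_t)+\frac\lambda2t(1-t)d_Y^2(\gamma_0,\gamma_1)\le(1-t)E(\gamma_0)+tE(\gamma_1)$. *)

(* Defs.v *)
From HB Require Import structures.
From mathcomp Require Import all_boot all_order all_algebra.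
From mathcomp Require Import all_classical all_reals all_analysis.

Set Implicit Arguments.
Unset Strict Implicit.
Unset Printing Implicit Defensive.

Import Order.TTheory GRing.Theory Num.Theory.
Import numFieldNormedType.Exports.

Local Open Scope classical_set_scope.
Local Open Scope ring_scope.
Local Open Scope ereal_scope.

Section slope_and_length.
Context {R : realType} {X : metricType R}.
Implicit Types (E : X -> \bar R) (Y : set X) (gamma : R -> X).

Definition slope E (x : X) : \bar R :=
  if E x == +oo then +oo
  else if `[< isolated [set: X] x >] then 0
  else limf_esup (fun y => maxe (E x - E y) 0 / (mdist x y)%:E) x^'.

Definition slope_dom E : set X := [set x | slope E x < +oo].

(* A curve [0, 1] -> X is encoded by a map R -> X; no definition below depends
   on its values outside of [0, 1]. *)
Definition abs_cont_curve gamma : Prop :=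
  exists2 m : R -> R,
    (@lebesgue_measure R).-integrable `[0%R, 1%R] (EFin \o m) &
    forall s t : R, (0 <= s)%R -> (s < t)%R -> (t <= 1)%R ->
      (mdist (gamma s) (gamma t))%:E
        <= \int[lebesgue_measure]_(u in `[s, t]) (m u)%:E.

Definition metric_derivative gamma (t : R) : \bar R :=
  limf_esup (fun s : R => (mdist (gamma s) (gamma t) / `|s - t|)%:E)
            (within `[0%R, 1%R] t^').

Definition curve_length gamma : \bar R :=
  \int[lebesgue_measure]_(t in `[0%R, 1%R]) metric_derivative gamma t.

Definition curve_in Y gamma : Prop :=
  forall t : R, (0 <= t <= 1)%R -> Y (gamma t).

Definition length_dist Y (y y' : X) : \bar R :=
  ereal_inf [set curve_length gamma | gamma in
    [set gamma | [/\ abs_cont_curve gamma, curve_in Y gamma,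
                     gamma 0%R = y & gamma 1%R = y']]].

Definition geodesic Y gamma : Prop :=
  [/\ curve_in Y gamma,
      length_dist Y (gamma 0%R) (gamma 1%R) < +oo &
      forall s t : R, (0 <= s <= 1)%R -> (0 <= t <= 1)%R ->
        length_dist Y (gamma s) (gamma t)
          = `|t - s|%:E * length_dist Y (gamma 0%R) (gamma 1%R)].

Definition geodesic_space Y : Prop :=
  forall y y' : X, Y y -> Y y' ->
    exists gamma, [/\ geodesic Y gamma, gamma 0%R = y & gamma 1%R = y'].

Definition geodesically_convex (lambda : R) E Y : Prop :=
  forall gamma, geodesic Y gamma -> forall t : R, (0 <= t <= 1)%R ->
    E (gamma t)
      + (lambda / 2 * t * (1 - t))%:E
        * length_dist Y (gamma 0%R) (gamma 1%R) ^+ 2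
    <= (1 - t)%:E * E (gamma 0%R) + t%:E * E (gamma 1%R).

(* The slope is the one of the ambient space (X, mdist), whatever the distance
   d on Y. *)
Definition HWI (lambda : R) E Y (d : X -> X -> \bar R) : Prop :=
  forall x x' : X, Y x -> slope_dom E x -> Y x' ->
    E x <= E x' + d x x' * slope E x - (lambda / 2)%:E * d x x' ^+ 2.

End slope_and_length.

(* Main.v *)
(* The slope in both HWI inequalities is the one of the ambient space, so the
   point is to replace d_X by d_Y.  Along a Y-geodesic gamma from y to y' with
   D := d_Y(y, y'), the HWI inequality between y and gamma_t, the
   lambda-convexity of E, and d_X(y, gamma_t) <= d_Y(y, gamma_t) = t D yield the
   claim up to an error O(t) after division by t; then t tends to 0.

   The substantial ingredient is d_X <= d_Y, i.e. that the length of an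
   absolutely continuous curve dominates the distance of its endpoints.  If m
   is a majorant of the curve, M a primitive of m and
   f(t) := d_X(gamma_0, gamma_t), then g := M - f is continuous and
   nondecreasing, so by Fatou's lemma the lower limit Q of its difference
   quotients satisfies \int Q <= g(1) - g(0).  By Lebesgue's differentiation
   theorem m - Q <= |gamma'| almost everywhere, and integration gives
   f(1) - f(0) <= \int |gamma'|. *)
Require Import Defs.
From mathcomp Require Import all_boot all_order all_algebra.
From mathcomp Require Import all_classical all_reals all_analysis.
From mathcomp Require Import measurable_realfun ring lra.

Set Implicit Arguments.
Unset Strict Implicit.
Unset Printing Implicit Defensive.

Import Order.TTheory GRing.Theory Num.Theory.
Import numFieldNormedType.Exports.

Local Open Scope classical_set_scope.
Local Open Scope ring_scope.
Local Open Scope ereal_scope.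

(* [g] need not be measurable: the integral of a nonnegative function is a
   supremum over the simple functions below it. *)
Lemma ae_ge0_le_integral_nonmeasurable d (T : measurableType d) (R : realType)
    (mu : {measure set T -> \bar R}) (D : set T) (f g : T -> \bar R) :
  measurable D -> measurable_fun D f ->
  (forall x, D x -> 0 <= f x) -> (forall x, D x -> 0 <= g x) ->
  {ae mu, forall x, D x -> f x <= g x} ->
  \int[mu]_(x in D) f x <= \int[mu]_(x in D) g x.
Proof.
move=> mD mf f0 g0 [N [mN N0 fgN]].
rewrite (ge0_negligible_integral mN)//.
rewrite ge0_integralE; last by move=> x [/f0].
rewrite ge0_integralE//; apply: ereal_sup_le => _ [h /= hf <-].
exists h => // x; apply: le_trans (hf x) _; rewrite !patchE.
case: ifPn => [/set_mem[Dx Nx]|_]; last first.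
  by case: ifPn => // /set_mem; exact: g0.
rewrite mem_set//; apply: contrapT => fgx; apply: Nx; apply: fgN => /=.
by apply: contra_not fgx; exact.
Qed.

(** * Difference quotients of monotone functions and of primitives *)

Section diff_quotient.
Context {R : realType}.
Notation mu := (@lebesgue_measure R).
Implicit Types (g : R -> R) (a b h : R).

Lemma continuous_primitive g a b : continuous g ->
  exists G : R -> R, forall x, (a < x < b)%R -> is_derive x 1%R G (g x).
Proof.
move=> cg; exists (fun x => (\int[mu]_(t in `[a, x]) g t)%R) => x /andP[ax xb].
have ig : mu.-integrable `[a, b] (EFin \o g).
  apply: continuous_compact_integrable; first exact: segment_compact.
  exact: continuous_subspaceT.
have [dG G'] := continuous_FTC1_closed xb ig ax (cg x).
by apply: DeriveDef => //; rewrite -derive1E.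
Qed.

Lemma continuous_diff_quotient g h : continuous g ->
  continuous (fun t => (g (t + h) - g t) / h)%R.
Proof.
move=> cg t; apply: cvgM; last exact: cvg_cst.
apply: cvgB; last exact: cg.
apply: (cvg_comp _ g _ (cg (t + h)%R)).
by apply: cvgD => //; exact: cvg_cst.
Qed.

(** With [G] a primitive of [g], the integrand has the antiderivative [F t = (G (t + h) - G t) / h].
    By the mean value theorem [F b] and [F a] are values of [g] at points of [[b, b + h]] and
    [[a, a + h]], so monotonicity bounds [F b - F a]. *)
Lemma integral_diff_quotient_le g a b h : (a < b)%R -> (0 < h)%R ->
  continuous g -> {homo g : x y / (x <= y)%R} ->
  \int[mu]_(t in `[a, b]) ((g (t + h) - g t) / h)%:E <= (g (b + h) - g a)%:E.
Proof.
move=> ab h0 cg ndg.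
(* The margins of width 1 make [G] derivable at every point of [[a, b + h]], endpoints included. *)
have [G G'] := @continuous_primitive g (a - 1) (b + h + 1) cg.
have cG x y : (a - 1 < x)%R -> (y < b + h + 1)%R ->
    {within `[x, y], continuous G}.
  move=> ax yb; apply: continuous_in_subspaceT => z.
  rewrite inE/= in_itv/= => /andP[xz zy].
  apply/differentiable_continuous/derivable1_diffP.
  by have [] := G' z; rewrite ?(lt_le_trans ax xz) ?(le_lt_trans zy yb).
pose F t := ((G (t + h) - G t) / h)%R.
have F' t : (a <= t <= b)%R -> is_derive t 1%R F ((g (t + h) - g t) / h)%R.
  move=> /andP[at_ tb].
  have H1 : is_derive t 1%R G (g t) by apply: G'; lra.
  have H2 : is_derive t 1%R (fun t => G (t + h)%R) (g (t + h)%R).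
    have H3 : is_derive (t + h)%R 1%R G (g (t + h)%R) by apply: G'; lra.
    have := @is_derive1_comp _ G (shift h) _ _ _ H3 (is_derive_shift _ _ _).
    by rewrite mulr1.
  have H5 : is_derive t 1%R ((fun t => G (t + h)%R) - G)%R
    (g (t + h) - g t)%R by apply: is_deriveB.
  have := @is_deriveZ _ _ _ _ (h^-1)%R _ _ _ H5.
  rewrite /F; set u := (_ \*: _)%R; rewrite (_ : u = F); last first.
    by apply/funext => z; rewrite /u /F/= mulrC.
  by rewrite /= /GRing.scale/= mulrC.
have cF : {within `[a, b], continuous F}.
  apply: continuous_in_subspaceT => z; rewrite inE/= in_itv/= => zab.
  by apply/differentiable_continuous/derivable1_diffP; have [] := F' z zab.
rewrite (@continuous_FTC2 _ _ F)//; last 3 first.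
- exact/continuous_subspaceT/continuous_diff_quotient.
- have [] := (continuous_within_itvP F ab).1 cF.
  move=> _ Fa Fb; split => // t; rewrite in_itv/= => /andP[at_ tb].
  by have [] := F' t; rewrite ?(ltW at_) ?(ltW tb).
- move=> t; rewrite in_itv/= => /andP[at_ tb].
  have /F'[_ F't] : (a <= t <= b)%R by rewrite !ltW.
  by rewrite derive1E.
rewrite -EFinB lee_fin /F.
have mvt x : (a <= x <= b)%R ->
    exists2 c, (x <= c <= x + h)%R & ((G (x + h) - G x) / h)%R = g c.
  move=> /andP[ax xb].
  have xh : (x <= x + h)%R by lra.
  have [y||c cx ->] := @MVT_segment R G g x (x + h) xh.
  - by rewrite in_itv/= => /andP[? ?]; apply: G'; lra.
  - by apply: cG; lra.
  exists c; first by move: cx; rewrite in_itv.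
  by rewrite addrAC subrr add0r mulfK// gt_eqF.
have [|c /andP[_ cb] ->] := mvt b; first by rewrite lexx ltW.
have [|c' /andP[ca _] ->] := mvt a; first by rewrite lexx ltW.
by rewrite lerB// ndg.
Qed.

Lemma limn_esup_le_near (u : (\bar R)^nat) (c : \bar R) :
  (\forall n \near \oo, u n <= c) -> limn_esup u <= c.
Proof.
move=> uc; apply: (@le_trans _ _ (ereal_sup (u @` [set n | u n <= c]))).
  by apply: ereal_inf_lbound; exists [set n | u n <= c].
by apply: ge_ereal_sup => _ [n /= + <-].
Qed.

Lemma limn_einf_ge_near (u : (\bar R)^nat) (c : \bar R) :
  (\forall n \near \oo, c <= u n) -> c <= limn_einf u.
Proof.
move=> uc; rewrite /limn_einf leeNr; apply: limn_esup_le_near.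
by apply: filterS uc => n; rewrite /= leeN2.
Qed.

Lemma integral_limn_einf_diff_quotient_le g a b : (a < b)%R ->
  continuous g -> {homo g : x y / (x <= y)%R} ->
  \int[mu]_(t in `[a, b])
    limn_einf (fun n => ((g (t + harmonic n) - g t) / harmonic n)%:E)
  <= (g b - g a)%:E.
Proof.
move=> ab cg ndg.
apply: le_trans (fatou _ _ _ _) _ => //.
- move=> n; apply/measurable_EFinP; apply: measurable_funTS.
  apply: continuous_measurable_fun.
  exact: (@continuous_diff_quotient _ (harmonic n)).
- move=> n t _; rewrite lee_fin divr_ge0 ?harmonic_ge0// subr_ge0 ndg//.
  by rewrite lerDl harmonic_ge0.
(* After Fatou, the lower limit of the integrals is at most their upper limit. The bounds
   [g (b + harmonic n) - g a] are eventually within [e] of [g b - g a] by continuity at [b]. *)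
apply/lee_addgt0Pr => e e0; apply: le_trans (limn_einf_sup _) _.
apply: limn_esup_le_near.
have : (g (b + harmonic n))%R @[n --> \oo] --> g (b + 0)%R.
  apply: (cvg_comp _ g _ (cg _)).
  by apply: cvgD; [exact: cvg_cst|exact: cvg_harmonic].
move=> /cvgrPdist_le/(_ _ e0); rewrite addr0; apply: filterS => n ge.
apply: le_trans (integral_diff_quotient_le ab (harmonic_gt0 n) cg ndg) _.
rewrite -EFinD lee_fin; move: ge; rewrite ler_distlC => /andP[_]; lra.
Qed.

(** Splitting off the constant integral over []-oo, x - 1]] leaves a parameterized integral on
    [[x - 1, x + 1]], continuous at the interior point [x]. *)
Lemma continuous_Rintegral_itvNy (f : R -> R) :
  mu.-integrable setT (EFin \o f) ->
  continuous (fun x => \int[mu]_(t in `]-oo, x]) f t)%R.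
Proof.
move=> intf x.
have x1 : (x - 1 <= x + 1)%R by lra.
have x1' : (x - 1 < x + 1)%R by lra.
have intS (i : interval R) : mu.-integrable [set` i] (EFin \o f).
  exact: integrableS intf.
have := parameterized_integral_continuous x1 (intS _).
move=> /(continuous_within_itvP _ x1')[/(_ x)+ _ _].
rewrite in_itv/= => /(_ ltac:(lra)) cP.
pose F y := (\int[mu]_(t in `]-oo, (x - 1)%R]) f t +
  parameterized_integral mu (x - 1) y f)%R.
have FE y : (x - 1 <= y)%R -> F y = (\int[mu]_(t in `]-oo, y]) f t)%R.
  move=> xy.
  have := @Rintegral_itvB R f -oo%O (BRight y) (x - 1)%R (intS _) isT xy.
  rewrite Rintegral_itv_obnd_cbnd// /F /parameterized_integral => <-.
  by rewrite addrC subrK.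
rewrite /continuous_at -FE; last by lra.
apply: cvg_trans; last by apply: (@cvgD _ _ _ _ _ _ _ _ _ (cvg_cst _) cP).
apply: near_eq_cvg; near=> y; apply: FE; near: y.
by apply: filterS (@lt_nbhsr _ (x - 1)%R x _) => [z /ltW|]; lra.
Unshelve. all: by end_near. Qed.

Lemma derivable_diff_quotient_harmonic (f : R -> R) (x : R) :
  derivable f x 1%R ->
  ((f (x + harmonic n) - f x) / harmonic n)%R @[n --> \oo]
    --> f^`()%classic x.
Proof.
move=> df; rewrite derive1E.
have /cvg_dnbhs_at_right/cvg_at_rightP H :
  (h^-1 *: ((f \o shift x) (h *: 1) - f x))%R @[h --> (0%R : R)^']
    --> ('D_1 f x)%R := df.
have := H harmonic (conj harmonic_gt0 cvg_harmonic).
apply: cvg_trans; apply: near_eq_cvg; near=> n.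
by rewrite /= /GRing.scale/= mulr1 [(_ + x)%R]addrC mulrC.
Unshelve. all: by end_near. Qed.

(** Lets the sets [V] in the upper limit defining [metric_derivative] be tested along one sequence
    decreasing to [t]; [t < 1] leaves room on the right. *)
Lemma near_within_add_harmonic (t : R) (V : set R) : (0 <= t < 1)%R ->
  within `[0%R, 1%R] t^' V -> \forall n \near \oo, V (t + harmonic n)%R.
Proof.
move=> /andP[t0 t1] tV.
have H : (t + harmonic n)%R @[n --> \oo] --> (t + 0)%R.
  by apply: cvgD; [exact: cvg_cst|exact: cvg_harmonic].
have /H : nbhs (t + 0)%R [set s | s != t -> s \in `[0%R, 1%R] -> V s].
  by rewrite addr0.
have tle : \forall n \near \oo, (t + harmonic n <= 1)%R.
  have t10 : (t + 0 < 1)%R by rewrite addr0.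
  exact: cvgr_le H _ t10.
apply: filterS2 tle => n tn; apply.
  by rewrite gt_eqF// ltrDl harmonic_gt0.
by rewrite in_itv/= tn andbT addr_ge0 ?harmonic_ge0.
Qed.

End diff_quotient.

(** * The length distance dominates the ambient distance *)

Section length_distance.
Context {R : realType} {X : metricType R}.
Notation mu := (@lebesgue_measure R).
Implicit Types (E : X -> \bar R) (Y : set X) (gamma : R -> X).

(** The supremum of an empty set is [-oo], so the point is that [t] is an accumulation point of
    [[0, 1]]: one steps right from the left half and left from the right half. *)
Lemma metric_derivative_ge0 gamma (t : R) : (0 <= t <= 1)%R ->
  0 <= metric_derivative gamma t.
Proof.
move=> /andP[t0 t1]; apply: le_ereal_inf_tmp => _ [V /= [e /= e0 tV] <-].
have [s [s0 s1 st se]] : exists s : R,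
    [/\ (0 <= s)%R, (s <= 1)%R, s != t & (`|t - s| < e)%R].
  pose r := Num.min (e / 2)%R (2^-1)%R.
  have [r0 re r1] : [/\ (0 < r)%R, (r <= e / 2)%R & (r <= 2^-1)%R].
    by rewrite /r lt_min !ge_min !lexx orbT/= divr_gt0//= invr_gt0.
  have [t2|t2] := leP t (2^-1)%R.
    exists (t + r)%R; split; [lra|lra|by apply/eqP; lra|].
    by rewrite opprD addNKr normrN gtr0_norm//; lra.
  exists (t - r)%R; split; [lra|lra|by apply/eqP; lra|].
  by rewrite opprB addrC subrK gtr0_norm//; lra.
apply: le_ereal_sup_tmp.
exists (mdist (gamma s) (gamma t) / `|s - t|)%:E.
  exists s => //; apply: tV => //=.
  by rewrite in_itv/= s0 s1.
by rewrite lee_fin divr_ge0// mdist_ge0.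
Qed.

(** Clamping time to [[0, 1]] freezes the curve outside, and [m] is extended by zero, so that later
    arguments can use functions on the whole line. *)
Lemma abs_cont_curve_majorant gamma : abs_cont_curve gamma ->
  exists2 m : R -> R, mu.-integrable setT (EFin \o m) &
    forall s t : R, (s <= t)%R ->
      (mdist (gamma (Num.max 0 (Num.min s 1))) (gamma (Num.max 0 (Num.min t 1)))
        <= \int[mu]_(u in `]s, t]) m u)%R.
Proof.
move=> [m im acg]; exists (m \_ `]0%R, 1%R]).
  rewrite -restrict_EFin; apply/integrable_restrict => //; rewrite setTI.
  by apply: integrableS im => //; exact: subset_itv_oc_cc.
move=> s t st.
set s' : R := Num.max 0%R (Num.min s 1%R).
set t' : R := Num.max 0%R (Num.min t 1%R).
have s't' : (s' <= t')%R.
  by rewrite /s' /t' ge_max !le_max lexx/= le_min !ge_min st lexx !orbT.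
rewrite -Rintegral_mkcondr.
(* Half-open intervals make this an exact equality, also when the clamped interval is empty. *)
have -> : `]s, t] `&` `]0%R, 1%R] = `]s', t']%classic.
  apply/seteqP; split => x /=;
    rewrite !in_itv/= /s' /t' gt_max le_max le_min gt_min.
    by move=> [/andP[-> ->] /andP[-> ->]]; rewrite orbT.
  move=> /andP[/andP[x0 /orP sx] /orP[|/andP[xt x1]]].
    by rewrite leNgt x0.
  by case: sx => [->|]; [rewrite xt x0 x1|rewrite ltNge x1].
move: s't'; rewrite le_eqVlt => /predU1P[->|s't'].
  by rewrite mdistxx set_itv_ge ?Rintegral_set0// bnd_simp ltxx.
have s'0 : (0 <= s')%R by rewrite le_max lexx.
have t'1 : (t' <= 1)%R by rewrite ge_max ler01 ge_min lexx orbT.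
have sub : `[s', t'] `<=` `[0%R, 1%R] by apply: subset_itvScc; rewrite bnd_simp.
have im' : mu.-integrable `[s', t'] (EFin \o m) by exact: integrableS im.
rewrite Rintegral_itv_obnd_cbnd; last first.
  by apply: integrableS im' => //; exact: subset_itv_oc_cc.
rewrite -lee_fin /Rintegral fineK; first exact: acg.
exact: integrable_fin_num.
Qed.

Lemma mdist_le_curve_length gamma : abs_cont_curve gamma ->
  (mdist (gamma 0%R) (gamma 1%R))%:E <= curve_length gamma.
Proof.
move=> /abs_cont_curve_majorant[m im mP].
pose c (t : R) := Num.max 0%R (Num.min t 1%R).
have c01 t : (0 <= t <= 1)%R -> c t = t.
  by move=> /andP[t0 t1]; rewrite /c min_l// max_r.
have c0 : c 0%R = 0%R by rewrite c01// lexx ler01.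
have c1 : c 1%R = 1%R by rewrite c01// lexx ler01.
pose f (t : R) := mdist (gamma 0%R) (gamma (c t)).
pose M (t : R) := (\int[mu]_(u in `]-oo, t]) m u)%R.
have imS (i : interval R) : mu.-integrable [set` i] (EFin \o m).
  exact: integrableS im.
have MB s t : (s <= t)%R -> (M t - M s)%R = (\int[mu]_(u in `]s, t]) m u)%R.
  by move=> st; rewrite /M Rintegral_itvB.
have fB s t : (f t - f s <= mdist (gamma (c s)) (gamma (c t)))%R.
  by rewrite lerBlDl metric_triangle.
have fM s t : (s <= t)%R -> (`|f t - f s| <= M t - M s)%R.
  move=> st; rewrite MB//; apply: le_trans (mP _ _ st).
  by rewrite ler_norml fB andbT lerNl opprB metric_sym fB.
have Mcont : continuous M by exact: continuous_Rintegral_itvNy.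
have fcont : continuous f.
  move=> t; apply/cvgrPdist_le => e e0.
  have /cvgrPdist_le/(_ e e0) := Mcont t; apply: filterS => s; apply: le_trans.
  have [st|/ltW ts] := leP s t.
    by apply: le_trans (fM _ _ st) _; exact: ler_norm.
  rewrite distrC; apply: le_trans (fM _ _ ts) _.
  by rewrite distrC ler_norm.
pose g := (fun t => M t - f t)%R.
have gcont : continuous g by move=> t; apply: cvgB; [exact: Mcont|exact: fcont].
have gnd : {homo g : x y / (x <= y)%R}.
  move=> s t st; have := le_trans (ler_norm _) (fM _ _ st); rewrite /g; lra.
pose q n t := ((g (t + harmonic n) - g t) / harmonic n)%:E.
have q0 n t : 0 <= q n t.
  by rewrite lee_fin divr_ge0 ?harmonic_ge0// subr_ge0 gnd// lerDl harmonic_ge0.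
pose Q t := limn_einf (q ^~ t).
have Qle := integral_limn_einf_diff_quotient_le ltr01 gcont gnd.
rewrite -/(\int[mu]_(t in `[0%R, 1%R]) Q t) in Qle.
have Q0 t : 0 <= Q t by apply: limn_einf_ge_near; exact: nearW.
have mQ : measurable_fun setT Q.
  apply: measurableT_comp => //; apply: measurable_fun_limn_esup => n.
  apply: measurableT_comp => //; apply/measurable_EFinP.
  exact: continuous_measurable_fun (@continuous_diff_quotient _ _ _ gcont).
have iQ : mu.-integrable `[0%R, 1%R] Q.
  apply/integrableP; split; first exact: measurable_funTS.
  under eq_integral do rewrite gee0_abs//.
  exact: le_lt_trans Qle (ltry _).
have int_m : \int[mu]_(t in `[0%R, 1%R]) (m t)%:E = (M 1 - M 0)%:E.
  rewrite MB ?ler01// Rintegral_itv_obnd_cbnd// /Rintegral fineK//.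
  exact: integrable_fin_num.
(* The positive part makes the integrand nonnegative, as needed for the comparison with a metric
   derivative not known to be measurable. *)
have main : (mdist (gamma 0%R) (gamma 1%R))%:E <=
    \int[mu]_(t in `[0%R, 1%R]) (((EFin \o m) \- Q)^\+ t).
  apply: (@le_trans _ _ (\int[mu]_(t in `[0%R, 1%R]) ((EFin \o m) \- Q) t)).
    rewrite integralB//= int_m.
    apply: (@le_trans _ _ ((M 1 - M 0)%:E - (g 1 - g 0)%:E)); last exact: leeB.
    by rewrite -EFinB lee_fin /g /f c0 c1 mdistxx; lra.
  apply: le_integral => //.
  - exact: integrableB.
  - by apply: integrable_funepos => //; exact: integrableB.
  - by move=> t _; rewrite funeposE le_max lexx.
apply: (le_trans main); apply: ae_ge0_le_integral_nonmeasurable => //.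
- apply: measurable_funepos; apply: emeasurable_funB.
    exact: (measurable_int mu).
  exact: measurable_funTS.
- by move=> t; rewrite /= in_itv/=; exact: metric_derivative_ge0.
have dM : {ae mu, forall x, derivable M x 1 /\ M^`()%classic x = m x}.
  apply: FTC1Ny => //; apply: open_integrable_locally => //; exact: openT.
(* At [t = 1] the points [t + harmonic n] leave [[0, 1]]. *)
have n1 : {ae mu, forall x : R, x != 1%R}.
  exists [set 1%R]; split => //; first exact: lebesgue_measure_set1.
  by move=> x /= /negP; rewrite negbK => /eqP.
move: dM n1; apply: filterS2; first exact: (ae_filter_ringOfSetsType mu).
move=> t [dMt M't] tn1 /=; rewrite in_itv/= => /andP[t0 t1].
have t01 : (0 <= t < 1)%R by rewrite t0 lt_neqAle tn1.
rewrite funeposE ge_max metric_derivative_ge0 ?t0// andbT.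
apply: le_ereal_inf_tmp => _ [V tV <-].
set u := ereal_sup _.
have t01V : within `[0%R, 1%R] t^' (V `&` `[0%R, 1%R]).
  by apply: filterI => //; exact: withinT.
have near_t := near_within_add_harmonic t01 t01V.
have := derivable_diff_quotient_harmonic dMt.
rewrite M't => /cvgrPdist_le near_m.
have uge s : V s -> (mdist (gamma s) (gamma t) / `|s - t|)%:E <= u.
  by move=> Vs; apply: ereal_sup_ubound; exists s.
have [n [/uge + _]] := filter_ex near_t.
case: u uge => [r| |] uge; [move=> _|by move=> _; exact: leey|by []].
(* For large [k] the quotient of [f] is at most [r], while that of [M] exceeds [m t - e] up to
   equality; their difference is [q k t]. *)
have : (m t - r)%:E <= Q t.
  apply/lee_addgt0Pr => e e0; rewrite -leeBlDr//; apply: limn_einf_ge_near.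
  apply: filterS2 near_t (near_m e e0) => k [/uge + tn01].
  have h0 := @harmonic_gt0 R k; move: tn01 h0.
  set h := harmonic k => tn01 h0.
  rewrite addrAC subrr add0r gtr0_norm// lee_fin => fh.
  rewrite ler_distlC => /andP[Mh _].
  rewrite lee_fin /q/= -/h /g.
  have := fB t (t + h)%R; rewrite (c01 t) ?t0// c01; last first.
    by move: tn01; rewrite /= in_itv.
  rewrite metric_sym => fh2.
  have : ((f (t + h) - f t) / h <= mdist (gamma (t + h)) (gamma t) / h)%R.
    by rewrite ler_pM2r// invr_gt0.
  have -> : ((M (t + h) - f (t + h) - (M t - f t)) / h =
    (M (t + h) - M t) / h - (f (t + h) - f t) / h)%R by ring.
  lra.
case: (Q t) => [x| |] //=; rewrite ?leNye// -EFinB !lee_fin; lra.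
Qed.

Lemma mdist_le_length_dist Y (y y' : X) :
  (mdist y y')%:E <= length_dist Y y y'.
Proof.
apply: le_ereal_inf_tmp => _ [gamma [acg _ <- <-] <-].
exact: mdist_le_curve_length.
Qed.

Lemma slope_ge0 E (x : X) : 0 <= slope E x.
Proof.
rewrite /slope; case: ifPn => [_|_]; first exact: leey.
case: ifPn => // /asboolPn nisol.
apply: le_ereal_inf_tmp => _ [V /= xV <-].
have [y [xy Vy]] : exists y, y != x /\ V y.
  apply: contrapT => noy; apply: nisol; split; first by rewrite inE.
  exists [set y | y != x -> V y]; first exact: xV.
  rewrite setIT; apply/seteqP; split => [z /= Vz|z ->/=]; last by rewrite eqxx.
  by apply: contrapT => /eqP zx; apply: noy; exists z; split => //; exact: Vz.
apply: le_ereal_sup_tmp; exists (maxe (E x - E y) 0 / (mdist x y)%:E).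
  by exists y.
by rewrite mule_ge0 ?inve_ge0 ?lee_fin ?mdist_ge0// le_max lexx orbT.
Qed.

End length_distance.

(** * Transfer of the HWI inequality along a geodesic *)

Theorem proposition2p4 (R : realType) (lambda : R) (X : metricType R)
    (E : X -> \bar R) (Y : set X)
    (hE : forall x : X, (-oo < E x)%E)
    (hY : geodesic_space Y)
    (hconv : geodesically_convex lambda E Y)
    (hHWI : HWI lambda E Y (fun x x' : X => (mdist x x')%:E)) :
  HWI lambda E Y (length_dist Y).
Proof.
move=> y y' Yy Sy Yy'.
have [gamma [geo g0 g1]] := hY y y' Yy Yy'.
have [gY Dfin gD] := geo; rewrite g0 g1 in Dfin gD.
have := mdist_le_length_dist Y y y'.
have := slope_ge0 E y.
have Eyfin : E y < +oo.
  rewrite ltey; apply/eqP => Ey; move: Sy.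
  by rewrite /slope_dom /= /slope Ey eqxx ltxx.
have HW t (t01 : (0 <= t <= 1)%R) := hHWI y (gamma t) Yy Sy (gY t t01).
have Sfin : slope E y < +oo := Sy.
move: (hE y) Eyfin HW Sfin.
case Ee: (E y) => [e0| |]// _ _.
case Se: (slope E y) => [s| |]// HW _; rewrite lee_fin => s0.
have gD0 t : (0 <= t <= 1)%R -> 
    (mdist y (gamma t))%:E <= t%:E * length_dist Y y y'.
  move=> /[dup] t01 /andP[t0 _].
  have := gD 0%R t; rewrite subr0 ger0_norm// => <- //; last first.
    by rewrite lexx ler01.
  by rewrite g0; exact: mdist_le_length_dist.
have conv := hconv _ geo; rewrite g0 g1 Ee in conv.
case De : (length_dist Y y y') Dfin gD gD0 conv => [d| |]// _ gD gD0 conv.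
rewrite lee_fin => d0; have {}d0 : (0 <= d)%R := le_trans (mdist_ge0 _ _) d0.
have [E1|E1] := eqVneq (E y') +oo; first by rewrite E1 -EFin_expe -!EFinM leey.
move: (hE y') E1 conv; case: (E y') => [e1| |]// _ _ conv.
rewrite -EFin_expe -!EFinM -!EFinD lee_fin.
have key t : (0 < t < 1)%R ->
    (e0 <= e1 + d * s - lambda / 2 * d ^+ 2 +
      t * ((`|lambda| + lambda) / 2 * d ^+ 2))%R.
  move=> /andP[t0 t1]; have t01 : (0 <= t <= 1)%R by rewrite !ltW.
  (* [E (gamma t)] is finite: convexity with finite end values excludes [+oo], and [hE] excludes
     [-oo]. *)
  move: (HW t t01) (conv t t01) (gD0 t t01) (hE (gamma t)).
  case: (E (gamma t)) => [et| |]//.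
  rewrite -!EFin_expe -!EFinM -!EFinD !lee_fin.
  set del := mdist _ _ => H1 H2 H3 _.
  have del0 : (0 <= del)%R := mdist_ge0 _ _.
  rewrite -(ler_pM2l t0).
  have H4 : (del * s <= t * d * s)%R by rewrite ler_wpM2r.
  (* The sign of [lambda] is unknown, so [del <= t * d] can be used only after passing to the
     absolute value; this error is quadratic in [t]. *)
  have H5 : (- (lambda / 2 * (del * del)) <=
      `|lambda| / 2 * (t * d * (t * d)))%R.
    apply: (@le_trans _ _ (`|lambda| / 2 * (del * del))%R).
      rewrite -mulNr ler_wpM2r ?mulr_ge0// -mulNr ler_wpM2r//.
      by rewrite -normrN ler_norm.
    by rewrite ler_wpM2l ?divr_ge0// ler_pM.
  lra.
set K := ((`|lambda| + lambda) / 2 * d ^+ 2)%R in key.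
have K0 : (0 <= K)%R.
  by rewrite mulr_ge0 ?sqr_ge0// divr_ge0// -lerBlDr sub0r -normrN ler_norm.
apply/ler_addgt0Pr => e e_gt0.
have K1 : (0 < K + 1 + e)%R by lra.
(* This [t] lies strictly between 0 and 1 and satisfies [t * K <= e]. *)
have := key (e / (K + 1 + e))%R.
rewrite ltr_pdivrMr// mul1r divr_gt0//= => /(_ ltac:(lra)) /le_trans; apply.
rewrite lerD2l mulrAC ler_pdivrMr// ler_wpM2l ?ltW//; lra.
Qed.
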